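(* Let $M=(S^1)^{\times4}$ with angular coordinates $\theta_1,\dots,\theta_4$, $S^1=\mathbb{R}/2\pi\mathbb{Z}$, with the pre-symplectic form $\eta=d\theta_3\wedge d\theta_4$, whose kernel $K$ is spanned by $\frac{\partial}{\partial\theta_1},\frac{\partial}{\partial\theta_2}$; let $G$ be spanned by $\frac{\partial}{\partial\theta_3},\frac{\partial}{\partial\theta_4}$, and $\pi=\frac{\partial}{\partial\theta_3}\wedge\frac{\partial}{\partial\theta_4}$. Consider the Koszul $L_\infty[1]$-algebra $(\Omega_{\mathrm{hor}}(M)[2],\lambda_1,\lambda_2,\lambda_3)$ of $(M,\eta)$, which governs the deformations of $\eta$ as a pre-symplectic form of fixed rank. Then the closed horizontal $2$-form $$B=\cos(\theta_3)\,d\theta_1\wedge d\theta_3+\cos(\theta_4)\,d\theta_2\wedge d\theta_4$$ satisfies $\mathrm{Kr}([B])=[\lambda_2(B,B)]\neq0$. In particular, the Kuranishi map is not identically zero and the deformation problem of the pre-symplectic form $\eta$ is formally obstructed.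
   Context: $\Omega_{\mathrm{hor}}(M)$ is the complex of differential forms on $M$ that vanish when all arguments lie in $K$ (with de Rham differential), and $\Omega_{\mathrm{hor}}(M)[2]$ has degree $k$ component $\Omega^{k+2}_{\mathrm{hor}}(M)$. Here $\lambda_1=d$, and $\lambda_2(\alpha[2]\odot\beta[2])=-\big(\mathcal{L}_\pi(\alpha\wedge\beta)-\mathcal{L}_\pi(\alpha)\wedge\beta-(-1)^{|\alpha|}\alpha\wedge\mathcal{L}_\pi(\beta)\big)[2]$, where $\mathcal{L}_\pi=\iota_\pi\circ d-d\circ\iota_\pi$ and $\iota_{X\wedge Y}=\iota_X\circ\iota_Y$; since $\pi$ is Poisson, $\lambda_3=0$. For an $L_\infty[1]$-algebra $(W,\{\lambda_k\}_{k\ge1})$, the Kuranishi map is $\mathrm{Kr}\colon H^0(W)\to H^1(W)$, $[w]\mapsto[\lambda_2(w,w)]$, with $H^\bullet(W)$ the cohomology of $(W,\lambda_1)$. The deformation problem governed by $W$ is formally obstructed if there is a class in $H^0(W)$ such that one (equivalently, any) representative $w\in W_0$ cannot be extended to a formal curve of Maurer-Cartan elements, i.e. there is no formal power series $w_t=\sum_{i\ge1}w_it^i$ with $w_i\in W_0$, $w_1=w$, and $\sum_{k\ge1}\frac1{k!}\lambda_k(w_t,\dots,w_t)=0$. *)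

(* Defs.v *)
From HB Require Import structures.
From mathcomp Require Import all_boot all_order all_algebra.
From mathcomp Require Import all_classical all_reals all_analysis.

Set Implicit Arguments.
Unset Strict Implicit.
Unset Printing Implicit Defensive.

Import Order.TTheory GRing.Theory Num.Theory.
Import numFieldNormedType.Exports.

Local Open Scope classical_set_scope.
Local Open Scope ring_scope.

(* L_oo[1]-algebras.  Only the underlying data are recorded: a vector space,
   the subspaces of homogeneous elements of each degree, and the multibrackets,
   lam [:: x_1; ...; x_k] being lambda_k(x_1, ..., x_k).  The generalized Jacobi
   identities are not part of the record; what the Kuranishi map needs of them
   is isolated in [Kr_well_defined]. *)
Record linf_data (R : realType) := LinfData {
  carrier :> lmodType R;
  component : int -> set carrier;
  lam : seq carrier -> carrier }.

Definition cocycle (R : realType) (W : linf_data R) (k : int) : set W :=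
  [set w | component k w /\ lam [:: w] = 0].

(* The class of w in H^k(W), as the set of its representatives. *)
Definition cls (R : realType) (W : linf_data R) (k : int) (w : W) : set W :=
  [set w' | cocycle k w' /\
            exists2 v : W, component (k - 1) v & w' = w + lam [:: v]].

Definition cohomology (R : realType) (W : linf_data R) (k : int) :
    set (set W) :=
  [set c | exists2 w : W, cocycle k w & c = cls k w].

(* The union of the classes [lambda_2(w,w)] over all representatives w of c;
   it is a single class exactly when [w] |-> [lambda_2(w,w)] is well defined. *)
Definition Kr (R : realType) (W : linf_data R) (c : set W) : set W :=
  \bigcup_(w in c) cls 1 (lam [:: w; w]).

Definition Kr_well_defined (R : realType) (W : linf_data R) : Prop :=
  forall w : W, cocycle 0 w ->
    cocycle 1 (lam [:: w; w]) /\ Kr (cls 0 w) = cls 1 (lam [:: w; w]).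

(* The coefficient of t^n in \sum_(k >= 1) lambda_k(w_t, ..., w_t) / k! for
   w_t = \sum_(i >= 1) w_i t^i; only k <= n contribute. *)
Definition MC_coef (R : realType) (W : linf_data R) (ws : nat -> W) (n : nat) :
    W :=
  \sum_(1 <= k < n.+1) (k`!%:R : R)^-1 *:
    \sum_(i : k.-tuple 'I_n.+1 |
            all (fun j : 'I_n.+1 => (0 < j)%N) i &&
            ((\sum_(j <- i) (j : nat))%N == n))
      lam [seq ws (nat_of_ord j) | j : 'I_n.+1 <- i].

Definition extends_to_formal_MC (R : realType) (W : linf_data R) (w : W) :
    Prop :=
  exists ws : nat -> W,
    [/\ forall i, (0 < i)%N -> component 0 (ws i), ws 1%N = w
      & forall n, MC_coef ws n = 0].

Definition formally_obstructed (R : realType) (W : linf_data R) : Prop :=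
  exists2 c : set W, cohomology 0 c &
    forall w, c w -> ~ extends_to_formal_MC w.

(* The torus is R^4 / (2 pi Z)^4: tensors on it are (2 pi Z)^4-periodic tensors
   on R^4.  Its tangent bundle is trivialized by the coordinate fields. *)
Definition vec (R : realType) := 'rV[R]_4.
Definition vfield (R : realType) := vec R -> vec R.

(* A differential form, possibly of mixed degree: w p [:: v_1; ...; v_k] is its
   degree k part at p evaluated on v_1, ..., v_k. *)
Definition preform (R : realType) := 'rV[R]_4 -> seq 'rV[R]_4 -> R.

Definition smooth_fun (R : realType) (f : 'rV[R]_4 -> R) : Prop :=
  forall (vs : seq 'rV[R]_4) (p : 'rV[R]_4),
    differentiable (foldr (fun v g => 'D_v g) f vs) p.

Record is_form (R : realType) (w : preform R) : Prop := IsForm {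
  form_periodic : forall (i : 'I_4) p vs,
    w (p + (2 * pi) *: delta_mx 0 i) vs = w p vs;
  form_smooth : forall vs, smooth_fun (w ^~ vs);
  form_multilinear : forall p s1 s2 (a : R) u v,
    w p (s1 ++ (a *: u + v) :: s2) =
      a * w p (s1 ++ u :: s2) + w p (s1 ++ v :: s2);
  form_alternating : forall p s1 s2 s3 v,
    w p (s1 ++ v :: s2 ++ v :: s3) = 0 }.

(* For negative n only the zero form is homogeneous of degree n. *)
Definition homogeneous (R : realType) (n : int) (w : preform R) : Prop :=
  forall p vs, Posz (size vs) <> n -> w p vs = 0.

(* The number of pairs i < j such that m_i is false and m_j is true, i.e. the
   number of inversions of the shuffle listing the true positions first. *)
Fixpoint shuffle_inv (m : seq bool) : nat :=
  if m is b :: m' then ((if b then 0 else count id m') + shuffle_inv m')%N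
  else 0%N.

(* Sum over shuffles; dx /\ dy evaluates to dx(u) dy(v) - dx(v) dy(u). *)
Definition wedge_form (R : realType) (a b : preform R) :
    preform R := fun p vs =>
  \sum_(m : (size vs).-tuple bool)
    (-1) ^+ shuffle_inv m * a p (mask m vs) * b p (mask (map negb m) vs).

(* The invariant formula for the exterior derivative on constant (hence
   commuting) vector fields. *)
Definition dR (R : realType) (w : preform R) : preform R := fun p vs =>
  \sum_(i < size vs)
    (-1) ^+ i * 'D_(nth 0 vs i) (w ^~ (take i vs ++ drop i.+1 vs)) p.

Definition iota_ (R : realType) (X : vfield R) (w : preform R) : preform R :=
  fun p vs => w p (X p :: vs).

(* A decomposable bivector field X /\ Y is given by its two factors. *)
Definition iota2 (R : realType) (X Y : vfield R) (w : preform R) : preform R :=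
  iota_ X (iota_ Y w).

Definition Lie2 (R : realType) (X Y : vfield R) (w : preform R) : preform R :=
  iota2 X Y (dR w) - dR (iota2 X Y w).

(* Multiplies the degree k part by (-1)^k. *)
Definition parity (R : realType) (w : preform R) : preform R :=
  fun p vs => (-1) ^+ size vs * w p vs.

Definition ker_dist (R : realType) (eta : preform R) (p : 'rV[R]_4) :
    set 'rV[R]_4 :=
  [set v | forall u, eta p [:: v; u] = 0].

(* A closed 2-form of constant rank. *)
Definition presymplectic (R : realType) (eta : preform R) : Prop :=
  [/\ is_form eta, homogeneous 2 eta, dR eta = 0 &
    exists r : nat, forall p,
      \rank (\matrix_(i < 4, j < 4)
               eta p [:: delta_mx 0 i : 'rV[R]_4; delta_mx 0 j]) = r].

(* In particular there is no nonzero horizontal form of degree 0. *)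
Definition horizontal (R : realType) (eta w : preform R) : Prop :=
  forall p vs, (forall v, v \in vs -> ker_dist eta p v) -> w p vs = 0.

Definition lambda2 (R : realType) (X Y : vfield R) (a b : preform R) :
    preform R :=
  - (Lie2 X Y (wedge_form a b) - wedge_form (Lie2 X Y a) b
     - wedge_form (parity a) (Lie2 X Y b)).

(* The complex Omega_hor[2], for pi = X /\ Y Poisson (so that lambda_3 = 0). *)
Definition koszul (R : realType) (eta : preform R) (X Y : vfield R) :
    linf_data R :=
  @LinfData R (preform R : lmodType R)
    (fun k => [set w | [/\ is_form w, homogeneous (k + 2) w
                         & horizontal eta w]])
    (fun s => match s with
              | [:: a] => dR a
              | [:: a; b] => lambda2 X Y a b
              | _ => 0
              end).

(* Indices of theta_1, ..., theta_4. *)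
Definition t1 : 'I_4 := @Ordinal 4 0 isT.
Definition t2 : 'I_4 := @Ordinal 4 1 isT.
Definition t3 : 'I_4 := @Ordinal 4 2 isT.
Definition t4 : 'I_4 := @Ordinal 4 3 isT.

Definition ptl (R : realType) (i : 'I_4) : vfield R := fun=> delta_mx 0 i.
Arguments ptl : clear implicits.

Definition dtheta (R : realType) (i : 'I_4) : preform R :=
  fun _ vs => if vs is [:: v] then v 0 i else 0.
Arguments dtheta : clear implicits.

Definition fmul (R : realType) (f : 'rV[R]_4 -> R) (w : preform R) :
    preform R :=
  fun p vs => f p * w p vs.

Definition span2 (R : realType) (X Y : vfield R) (p : 'rV[R]_4) :
    set 'rV[R]_4 :=
  [set v | exists a b : R, v = a *: X p + b *: Y p].

Definition eta (R : realType) : preform R :=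
  wedge_form (dtheta R t3) (dtheta R t4).
Arguments eta : clear implicits.

Definition Gdist (R : realType) : 'rV[R]_4 -> set 'rV[R]_4 :=
  span2 (ptl R t3) (ptl R t4).
Arguments Gdist : clear implicits.

Definition torus_koszul (R : realType) : linf_data R :=
  koszul (eta R) (ptl R t3) (ptl R t4).

Definition B (R : realType) : torus_koszul R :=
  fmul (fun p => cos (p 0 t3)) (wedge_form (dtheta R t1) (dtheta R t3)) +
  fmul (fun p => cos (p 0 t4)) (wedge_form (dtheta R t2) (dtheta R t4)).
Arguments B : clear implicits.

(* Main.v *)
Require Import Defs.
From mathcomp Require Import all_boot all_order all_algebra.
From mathcomp Require Import all_classical all_reals all_analysis.
From mathcomp Require Import ring lra.

Set Implicit Arguments.
Unset Strict Implicit.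
Unset Printing Implicit Defensive.

(** For closed forms a and b of degree 2 and the constant bivector X /\ Y, the
    bracket lambda_2(a, b) is the derivative of
      Q(a, b) = i_X a /\ i_Y b - i_Y a /\ i_X b
    ([lambda2_closed]); this follows from the graded Leibniz rules of the
    contractions and of d and from d d = 0.  In general Q(a, b) is not
    horizontal, which is why lambda_2(a, b), although exact, can represent a
    nonzero class of the horizontal complex.

    The Kuranishi map is well defined because Q(a, dv) differs from the exact
    form d Q(a, v) by a horizontal form when a is closed and a and v are
    horizontal ([pairing_exact], [lam2_cohomologous]).  That lambda_2(w, w) is
    itself horizontal is automatic: the kernel of eta has rank 2, so every
    3-form vanishes on it ([horizontal3]).

    For the form B, Q(B, B) takes the value 2 cos(theta_3) cos(theta_4) on the
    two fields spanning the kernel.  If lambda_2(B, B) = dz with z horizontal,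
    then C = Q(B, B) - z is closed and takes that same value there.  Evaluated
    on d/dtheta_1, d/dtheta_2, d/dtheta_3, the equation dC = 0 says that the
    derivative of this value along theta_3 is, up to sign, the divergence, in
    the variables theta_1 and theta_2, of a periodic vector field.  On the
    2-torus theta_3 = pi / 2, theta_4 = 0 the divergence would be the constant
    2, whereas a periodic divergence has mean zero
    ([torus_no_constant_divergence], [lam2_B_not_exact]).

    A formal Maurer-Cartan curve through w has d w_2 + lambda_2(w, w) / 2 = 0 as
    its coefficient of order 2, so lambda_2(w, w) would be exact; as w ranges
    over the class of B, this contradicts the nonvanishing just described. *)

Import Order.TTheory GRing.Theory Num.Theory.
Import numFieldNormedType.Exports.

Local Open Scope classical_set_scope.
Local Open Scope ring_scope.

(** * Smooth functions on R^4 *)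

Section Smooth.
Context {R : realType}.
Local Notation V := 'rV[R]_4.
Implicit Types (f g : V -> R) (p u v : V).

(** The recursion differentiates first and recurses afterwards, so that sums and
    products can be treated by induction on the order, all functions being
    quantified inside the induction; [smooth_fun] with its fixed list of
    directions does not lend itself to that. *)
Fixpoint Ck (n : nat) f : Prop :=
  (forall p, differentiable f p) /\
  if n is m.+1 then forall v, Ck m ('D_v f) else True.

Lemma Ck_diff n f p : Ck n f -> differentiable f p.
Proof. by case: n => [|n] [df _]. Qed.

Lemma CkW n f : Ck n.+1 f -> Ck n f.
Proof.
elim: n f => [|n IH] f [df Df]; split => // v; exact/IH/Df.
Qed.

Lemma smooth_CkP f : smooth_fun f <-> forall n, Ck n f.
Proof.
split=> [sf n|Cf vs].
  elim: n f sf => [|n IH] f sf; split => //; try exact: (sf [::]).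
  move=> v; apply: IH => vs p; have := sf (rcons vs v) p.
  by rewrite foldr_rcons.
suff H (ws : seq V) n h : Ck (size ws + n) h ->
    Ck n (foldr (fun v g => 'D_v g) h ws).
  by move=> p; apply: (@Ck_diff 0); apply: H.
elim/last_ind: ws h => [//|ws v IH] h.
by rewrite size_rcons foldr_rcons => -[_ /(_ v)]; exact: IH.
Qed.

Lemma derive_add f g v p : (forall q, differentiable f q) ->
  (forall q, differentiable g q) ->
  'D_v (fun q => f q + g q) p = 'D_v f p + 'D_v g p.
Proof. by move=> df dg; rewrite -deriveD//; exact: diff_derivable. Qed.

Lemma derive_mul f g v p : (forall q, differentiable f q) ->
  (forall q, differentiable g q) ->
  'D_v (fun q => f q * g q) p = 'D_v f p * g p + f p * 'D_v g p.
Proof.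
move=> df dg.
have := @deriveM _ _ f g p v (diff_derivable (df p)) (diff_derivable (dg p)).
by move=> E; rewrite [LHS]E /GRing.scale/= addrC mulrC.
Qed.

Lemma derive_const (c : R) v : 'D_v (fun _ : V => c) = (fun=> 0).
Proof. by apply/funext => p; exact: derive_cst. Qed.

Lemma Ck_const n (c : R) : Ck n (fun=> c).
Proof.
elim: n c => [|n IH] c; split => //; try (move=> p; exact: differentiable_cst).
by move=> v; rewrite derive_const.
Qed.

Lemma Ck_add n f g : Ck n f -> Ck n g -> Ck n (fun p => f p + g p).
Proof.
elim: n f g => [|n IH] f g [df Df] [dg Dg]; split => //;
  try by [move=> p; exact: differentiableD | exact: df].
move=> v; rewrite (funext (fun p => derive_add v p df dg)).
by apply: IH; [exact: Df|exact: Dg].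
Qed.

Lemma Ck_mul n f g : Ck n f -> Ck n g -> Ck n (fun p => f p * g p).
Proof.
elim: n f g => [|n IH] f g Cf Cg; have [df Df] := Cf; have [dg Dg] := Cg;
  split => //; try by [move=> p; exact: differentiableM | exact: df].
move=> v; rewrite (funext (fun p => derive_mul v p df dg)).
by apply: Ck_add; apply: IH; by [exact: Df|exact: Dg|exact: CkW].
Qed.

Lemma smooth_diff f : smooth_fun f -> forall p, differentiable f p.
Proof. by move=> sf; exact: (sf [::]). Qed.

Lemma smooth_derivable f : smooth_fun f -> forall p v, derivable f p v.
Proof. by move=> sf p v; exact/diff_derivable/smooth_diff. Qed.

Lemma smooth_derive f v : smooth_fun f -> smooth_fun ('D_v f).
Proof.
move=> /smooth_CkP Cf; apply/smooth_CkP => n; by have [_ /(_ v)] := Cf n.+1.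
Qed.

Lemma smooth_const (c : R) : smooth_fun (fun _ : V => c).
Proof. by apply/smooth_CkP => n; exact: Ck_const. Qed.

Lemma smooth_add f g : smooth_fun f -> smooth_fun g ->
  smooth_fun (fun p => f p + g p).
Proof.
by move=> /smooth_CkP Cf /smooth_CkP Cg; apply/smooth_CkP => n; exact: Ck_add.
Qed.

Lemma smooth_mul f g : smooth_fun f -> smooth_fun g ->
  smooth_fun (fun p => f p * g p).
Proof.
by move=> /smooth_CkP Cf /smooth_CkP Cg; apply/smooth_CkP => n; exact: Ck_mul.
Qed.

Lemma smooth_scale (c : R) f : smooth_fun f -> smooth_fun (fun p => c * f p).
Proof. by move=> sf; apply: smooth_mul => //; exact: smooth_const. Qed.

Lemma smooth_sum (I : Type) (r : seq I) (P : pred I) (F : I -> V -> R) :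
  (forall i, smooth_fun (F i)) ->
  smooth_fun (fun p => \sum_(i <- r | P i) F i p).
Proof.
move=> sF; elim: r => [|i r IH].
  under [X in smooth_fun X]eq_fun do rewrite big_nil.
  exact: smooth_const.
under [X in smooth_fun X]eq_fun do rewrite big_cons.
by case: (P i) => //; exact: smooth_add.
Qed.

Lemma derive_smooth_add f g v p : smooth_fun f -> smooth_fun g ->
  'D_v (fun q => f q + g q) p = 'D_v f p + 'D_v g p.
Proof. by move=> sf sg; rewrite derive_add//; exact: smooth_diff. Qed.

Lemma derive_smooth_mul f g v p : smooth_fun f -> smooth_fun g ->
  'D_v (fun q => f q * g q) p = 'D_v f p * g p + f p * 'D_v g p.
Proof. by move=> sf sg; rewrite derive_mul//; exact: smooth_diff. Qed.

Lemma derive_smooth_scale (c : R) f v p : smooth_fun f ->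
  'D_v (fun q => c * f q) p = c * 'D_v f p.
Proof.
move=> sf; rewrite derive_smooth_mul//; last exact: smooth_const.
by rewrite derive_cst mul0r add0r.
Qed.

Lemma derive_smooth_sum (I : Type) (r : seq I) (P : pred I) (F : I -> V -> R)
    v p : (forall i, smooth_fun (F i)) ->
  'D_v (fun q => \sum_(i <- r | P i) F i q) p =
  \sum_(i <- r | P i) 'D_v (F i) p.
Proof.
move=> sF; elim: r => [|i r IH].
  under eq_fun do rewrite big_nil.
  by rewrite derive_cst big_nil.
under eq_fun do rewrite big_cons.
rewrite big_cons; case: (P i) => //; rewrite derive_smooth_add// ?IH//.
exact: smooth_sum.
Qed.

Lemma derive_smooth_dir f (a : R) u v p : smooth_fun f ->
  'D_(a *: u + v) f p = a * 'D_u f p + 'D_v f p.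
Proof.
by move=> sf; have df := smooth_diff sf p; rewrite !deriveE// linearP.
Qed.

Lemma is_derive_line f p v (t : R) : smooth_fun f ->
  is_derive t 1 (fun s : R => f (p + s *: v)) ('D_v f (p + t *: v)).
Proof.
move=> sf; have D := @smooth_derivable f sf (p + t *: v) v.
(* The difference quotients along the line and along v coincide. *)
have E : (fun h : R => h^-1 *: (f (p + (h *: 1 + t) *: v) - f (p + t *: v))) =
         (fun h : R => h^-1 *: (f (h *: v + (p + t *: v)) - f (p + t *: v))).
  apply/funext => h; rewrite (_ : h *: (1 : R) + t = h + t).
    by rewrite scalerDl addrCA.
  by rewrite /GRing.scale/= mulr1.
split; first by rewrite /derivable E.
by rewrite /derive E.
Qed.

Lemma line_continuous f p v : smooth_fun f ->
  continuous (fun s : R => f (p + s *: v)).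
Proof.
move=> sf t; have D := is_derive_line p v t sf.
apply: differentiable_continuous; apply/derivable1_diffP.
exact: ex_derive.
Qed.

Lemma MVT_line f p v (a b : R) : smooth_fun f -> a < b ->
  exists2 c, c \in `]a, b[%R &
    f (p + b *: v) - f (p + a *: v) = (b - a) * 'D_v f (p + c *: v).
Proof.
move=> sf ab.
have [c cab E] := @MVT R (fun s => f (p + s *: v))
  (fun s => 'D_v f (p + s *: v)) a b ab
  (fun x _ => is_derive_line p v x sf)
  (continuous_subspaceT (@line_continuous f p v sf)).
by exists c => //; rewrite E mulrC.
Qed.

(** The mean value theorem along u applied to the increment along v, followed by
    the mean value theorem along v. *)
Lemma second_difference f p u v (h : R) : smooth_fun f -> 0 < h ->
  exists s t, [/\ s \in `]0, h[%R, t \in `]0, h[%R &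
    f (p + h *: u + h *: v) - f (p + h *: u) - f (p + h *: v) + f p =
    h * h * 'D_v ('D_u f) (p + s *: u + t *: v)].
Proof.
move=> sf h0.
have [s sh] := @MVT R (fun s => f (p + h *: v + s *: u) - f (p + s *: u))
  (fun s => 'D_u f (p + h *: v + s *: u) - 'D_u f (p + s *: u)) 0 h h0
  (fun x _ => is_deriveB (is_derive_line _ u x sf) (is_derive_line p u x sf))
  (continuous_subspaceT (fun x => continuousB
     (@line_continuous f (p + h *: v) u sf x) (@line_continuous f p u sf x))).
rewrite !scale0r !addr0 => Es.
have [t th] := MVT_line (p + s *: u) v (smooth_derive u sf) h0.
rewrite !subr0 !scale0r !addr0 => Et.
exists s, t; split=> //.
rewrite -mulrA -Et (addrAC p (s *: u)) mulrC.
move: Es; rewrite subr0 => <-; rewrite (addrAC p (h *: v)); ring.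
Qed.

(** Both mixed derivatives at p are within e / 2 of the same second difference
    quotient, for a step h small enough that the intermediate points of both
    expansions are close to p. *)
Lemma schwarz f u v p : smooth_fun f -> 'D_u ('D_v f) p = 'D_v ('D_u f) p.
Proof.
move=> sf; set a := LHS; set b := RHS.
apply/eqP; rewrite -subr_eq0 -normr_le0; apply/ler_addgt0Pr => e e0.
rewrite add0r.
have cont (w x : V) : {for p, continuous ('D_w ('D_x f))}.
  by apply: differentiable_continuous; apply: smooth_diff;
    do 2!apply: smooth_derive.
have close (w x : V) : \forall q \near p,
    `|'D_w ('D_x f) p - 'D_w ('D_x f) q| < e / 2.
  have := cont w x => /(@cvgrPdist_lt _ R^o); apply; lra.
have /nbhs_normP[d /= d0 Hd] := close v u.
have /nbhs_normP[d' /= d'0 Hd'] := close u v.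
have N0 : 0 < `|u| + `|v| + 1 by rewrite ltr_pwDr// addr_ge0.
pose h := Num.min d d' / (`|u| + `|v| + 1).
have h0 : 0 < h by rewrite divr_gt0// lt_min d0 d'0.
have small s t (x y : V) : s \in `]0, h[%R -> t \in `]0, h[%R ->
    `|x| + `|y| = `|u| + `|v| ->
    `|p - (p + s *: x + t *: y)| < Num.min d d'.
  rewrite !in_itv/= => /andP[s0 sh] /andP[t0 th] xy.
  rewrite -addrA opprD addNKr normrN.
  apply: le_lt_trans (ler_normD _ _) _; rewrite !normrZ !gtr0_norm//.
  have -> : Num.min d d' = h * (`|x| + `|y| + 1).
    by rewrite xy mulfVK// gt_eqF.
  have : s * `|x| <= h * `|x| by rewrite ler_wpM2r// ltW.
  have : t * `|y| <= h * `|y| by rewrite ler_wpM2r// ltW.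
  by rewrite !mulrDr mulr1 => ? ?; lra.
have [s [t [sh th E1]]] := second_difference p u v sf h0.
have [s' [t' [sh' th' E2]]] := second_difference p v u sf h0.
have E : 'D_v ('D_u f) (p + s *: u + t *: v) =
         'D_u ('D_v f) (p + s' *: v + t' *: u).
  apply: (@mulfI _ (h * h)); first by rewrite mulf_neq0// gt_eqF.
  apply: (etrans (esym E1)); apply: (etrans _ E2).
  by rewrite (addrAC p (h *: u)); congr (_ + _); exact: addrAC.
have := small s t u v sh th erefl; rewrite lt_min => /andP[/Hd + _].
have := small s' t' v u sh' th' (addrC _ _); rewrite lt_min => /andP[_ /Hd'].
rewrite /= -E -/a -/b.
move: ('D_v _ _) => z Ha Hb; clearbody a b; rewrite [e]splitr.
apply: le_trans (ler_distD z a b) _.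
by rewrite [`|z - b|]distrC; apply: lerD; exact: ltW.
Qed.

(** * Periodic divergences have mean zero *)

(** Stokes' theorem on a 2-torus, without integrals.  The average of g over the
    grid points k h along u is periodic along v, so by Rolle's theorem its
    derivative vanishes at some t; along the line at height t, the derivative of
    f along u then has grid average c.  It is also a Riemann sum, with error of
    order h, for the total increment of f over a period, which is zero.  The
    error is uniform in t because the second derivative of f is bounded on a
    compact square; this matters as t depends on h. *)
Lemma torus_no_constant_divergence (f g : V -> R) (u v : V) (l c : R) p :
  0 < l -> smooth_fun f -> smooth_fun g ->
  (forall q, f (q + l *: u) = f q) -> (forall q, g (q + l *: v) = g q) ->
  (forall s t,
    'D_u f (p + s *: u + t *: v) + 'D_v g (p + s *: u + t *: v) = c) ->
  c = 0.
Proof.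
move=> l0 sf sg fl gl fg.
pose F (st : 'rV[R]_2) := 'D_u ('D_u f) (p + st 0 0 *: u + st 0 1 *: v).
have Fc : continuous F.
  have cc i : continuous (fun st : 'rV[R]_2 => st 0 i).
    move=> st; apply: differentiable_continuous; exact: differentiable_coord.
  move=> st; apply: (@continuous_comp _ _ _
    (fun st : 'rV[R]_2 => p + st 0 0 *: u + st 0 1 *: v) ('D_u ('D_u f))).
    apply: (@continuousD _ V).
      apply: (@continuousD _ V); first exact: cst_continuous.
      by apply: continuousZr_tmp; exact: cc.
    by apply: continuousZr_tmp; exact: cc.
  by apply: differentiable_continuous; apply: smooth_diff;
    do 2!apply: smooth_derive.
(* The bound does not depend on the height t, which is chosen after h. *)
have [M HM] : exists M, forall s t, s \in `[0, l] -> t \in `[0, l] ->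
    `|'D_u ('D_u f) (p + s *: u + t *: v)| <= M.
  pose A := [set st : 'rV[R]_2 | forall i, `[0, l]%classic (st ord0 i)].
  have cA : compact A.
    exact: (@rV_compact R 2 (fun=> _) (fun=> @segment_compact R 0 l)).
  have [||z _ Hz] := @EVT_max_rV R 2 (fun st => `|F st|) A _ cA.
  - by exists 0 => i /=; rewrite mxE in_itv/= lexx ltW.
  - apply: continuous_subspaceT => st.
    by apply: (@cvg_norm _ R^o); [exact: nbhs_filter|exact: Fc].
  exists `|F z| => s t sl tl.
  have := Hz (\row_(i < 2) if i == 0 then s else t).
  rewrite /F !mxE/=; apply; rewrite inE => i; rewrite /= mxE.
  by case: ifP.
apply/eqP; apply: contraT => c0; exfalso.
(* The number of grid points makes the total error, at most l M h, smaller than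
   l |c|. *)
pose N := (Num.bound `|M * l / `|c| |).+1; pose h := l / N%:R.
have N0 : (0 : R) < N%:R by rewrite ltr0n.
have h0 : 0 < h by rewrite divr_gt0.
have Nh : N%:R * h = l by rewrite mulrC divfK// gt_eqF.
have Mh : M * h < `|c|.
  have cp : 0 < `|c| by rewrite normr_gt0.
  have : M * l / `|c| < N%:R.
    apply: le_lt_trans (ler_norm _) _; apply: lt_trans (archi_boundP _) _ => //.
    by rewrite ltr_nat.
  by rewrite ltr_pdivrMr// => E; rewrite /h mulrA ltr_pdivrMr// (mulrC `|c|).
have kh (k : 'I_N) : 0 <= k%:R * h /\ k%:R * h + h <= l.
  split; first by rewrite mulr_ge0// ltW.
  by rewrite -{2}[h]mul1r -mulrDl natr1 -Nh ler_wpM2r ?ler_nat// ltW.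
pose G (k : 'I_N) (t : R) := g (p + (k%:R * h) *: u + t *: v).
have dG (t : R) : is_derive t 1 (\sum_k G k : R -> R^o)
    (\sum_(k < N) 'D_v g (p + (k%:R * h) *: u + t *: v)).
  by apply: is_derive_sum => k; exact: is_derive_line.
have [] := @Rolle R (\sum_k G k : R -> R) 0 l l0.
- by move=> x _; apply: ex_derive; exact: dG.
- apply: continuous_subspaceT => x.
  by apply: differentiable_continuous; apply/derivable1_diffP;
    apply: ex_derive; exact: dG.
- by rewrite !fct_sumE; apply: eq_bigr => k _; rewrite /G scale0r addr0 gl.
move=> t tl dG0.
have : \sum_(k < N) 'D_v g (p + (k%:R * h) *: u + t *: v) = 0.
  by have [_ <-] := dG t; have [_ <-] := dG0.
pose q := p + t *: v.
have qE s : p + s *: u + t *: v = q + s *: u by rewrite addrAC.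
have {}fg s : 'D_v g (p + s *: u + t *: v) = c - 'D_u f (q + s *: u).
  by apply/eqP; rewrite eq_sym subr_eq addrC -(fg s t) qE.
under eq_bigr do rewrite fg.
rewrite big_split/= sumr_const card_ord sumrN => /eqP.
rewrite subr_eq0 => /eqP sumE.
(* Two mean values: the increment equals h times the derivative at some x, and
   the derivative at x differs from that at the grid point by at most M h. *)
have err (k : 'I_N) : `|(f (q + (k.+1%:R * h) *: u) - f (q + (k%:R * h) *: u)) -
    h * 'D_u f (q + (k%:R * h) *: u)| <= M * h * h.
  have [k0 kl] := kh k.
  have kk : k%:R * h < k.+1%:R * h by rewrite ltr_pM2r// ltr_nat.
  have [x + ->] := MVT_line q u sf kk.
  rewrite in_itv/= => /andP[kx xk].
  rewrite -mulrBl -natrB// subSnn mul1r -mulrBr normrM (gtr0_norm h0).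
  rewrite [leRHS]mulrC ler_pM2l//.
  have [y + ->] := MVT_line q u (smooth_derive u sf) kx.
  rewrite in_itv/= => /andP[ky yx].
  have xk' : x - k%:R * h <= h.
    by move: xk; rewrite -natr1 mulrDl mul1r => /ltW; rewrite lerBlDl.
  have xk0 : 0 <= x - k%:R * h by rewrite subr_ge0 ltW.
  rewrite normrM (ger0_norm xk0) mulrC -qE.
  apply: ler_pM => //; apply: HM; rewrite in_itv/=.
    apply/andP; split; first by apply: le_trans k0 _; exact: ltW.
    apply: le_trans kl; apply/ltW; apply: lt_trans yx _.
    by move: xk; rewrite -natr1 mulrDl mul1r.
  by move: tl; rewrite in_itv/= => /andP[/ltW-> /ltW->].
have tele : \sum_(k < N)
    (f (q + (k.+1%:R * h) *: u) - f (q + (k%:R * h) *: u)) = 0.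
  rewrite -(big_mkord xpredT
    (fun k => f (q + (k.+1%:R * h) *: u) - f (q + (k%:R * h) *: u))).
  by rewrite telescope_sumr// mul0r scale0r addr0 Nh fl subrr.
have lc : l * c = - \sum_(k < N)
    ((f (q + (k.+1%:R * h) *: u) - f (q + (k%:R * h) *: u)) -
     h * 'D_u f (q + (k%:R * h) *: u)).
  by rewrite sumrB tele sub0r opprK -mulr_sumr -sumE -[in RHS]mulr_natl -Nh
    [RHS]mulrCA [RHS]mulrA.
have : `|l * c| <= l * (M * h).
  rewrite lc normrN; apply: le_trans (ler_norm_sum _ _ _) _.
  apply: le_trans (ler_sum _ (fun k _ => err k)) _.
  rewrite sumr_const card_ord -[leLHS]mulr_natl -Nh.
  by rewrite -[leRHS]mulrA [h * _]mulrCA [h * h]lock -[M * h * h]mulrA -lock.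
by rewrite normrM (gtr0_norm l0) ler_pM2l// leNgt Mh.
Qed.

(** * Cosines of the coordinates *)

Lemma derive_coord (i : 'I_4) v p : 'D_v (fun q : V => q 0 i) p = v 0 i.
Proof.
have H : derivable (id : V -> V) p v by exact: derivable_id.
have := derive_mx H; rewrite derive_id => /matrixP/(_ 0 i).
by rewrite !mxE => <-.
Qed.

Lemma derive_comp_coord (F : R -> R) (i : 'I_4) v p :
  differentiable F (p 0 i) ->
  'D_v (fun q : V => F (q 0 i)) p = F^`()%classic (p 0 i) * v 0 i.
Proof.
move=> dF; have dc : differentiable (fun q : V => q 0 i : R) p.
  exact: differentiable_coord.
rewrite deriveE; last exact: (differentiable_comp dc dF).
rewrite (@diff_comp _ _ _ _ (fun q : V => q 0 i : R) F p dc dF) /=.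
by rewrite -(deriveE _ dc) derive_coord diff1E// mulrC.
Qed.

Lemma Ck_cos_sin n (i : 'I_4) :
  Ck n (fun q : V => cos (q 0 i)) /\ Ck n (fun q : V => sin (q 0 i)).
Proof.
have dc (p : V) : differentiable (@cos R) (p 0 i).
  by apply/derivable1_diffP; exact: ex_derive.
have ds (p : V) : differentiable (@sin R) (p 0 i).
  by apply/derivable1_diffP; exact: ex_derive.
have dx (p : V) : differentiable (fun q : V => q 0 i : R) p.
  exact: differentiable_coord.
elim: n => [|n [Cc Cs]]; split; split => //.
- by move=> p; exact: (differentiable_comp (dx p) (dc p)).
- by move=> p; exact: (differentiable_comp (dx p) (ds p)).
- by move=> p; exact: (differentiable_comp (dx p) (dc p)).
- move=> v; rewrite (funext (fun p => derive_comp_coord v (dc p))).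
  apply: Ck_mul; last exact: Ck_const.
  rewrite (_ : (fun q : V => _) = fun q => -1 * sin (q 0 i)).
    by apply: Ck_mul => //; exact: Ck_const.
  by apply/funext => q; rewrite derive1E derive_val mulN1r.
- by move=> p; exact: (differentiable_comp (dx p) (ds p)).
- move=> v; rewrite (funext (fun p => derive_comp_coord v (ds p))).
  apply: Ck_mul; last exact: Ck_const.
  rewrite (_ : (fun q : V => _) = fun q => cos (q 0 i)) //.
  by apply/funext => q; rewrite derive1E derive_val.
Qed.

Lemma smooth_cos (i : 'I_4) : smooth_fun (fun q : V => cos (q 0 i)).
Proof. by apply/smooth_CkP => n; have [] := Ck_cos_sin n i. Qed.

Lemma derive_cos (i : 'I_4) v p :
  'D_v (fun q : V => cos (q 0 i)) p = - (sin (p 0 i) * v 0 i).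
Proof.
rewrite derive_comp_coord; last by apply/derivable1_diffP; exact: ex_derive.
by rewrite derive1E derive_val mulNr.
Qed.
End Smooth.

(** * Contraction, wedge product and exterior derivative *)

Section Forms.
Context {R : realType}.
Local Notation V := 'rV[R]_4.
Implicit Types (a b w : preform R) (p u v : V) (s t vs : seq V).

Definition iprod v w : preform R := iota_ (fun=> v) w.
Definition LieD v w : preform R := fun p vs => 'D_v (w ^~ vs) p.
Definition smooth_form w := forall vs, smooth_fun (w ^~ vs).

Lemma wedge_nil a b p : wedge_form a b p [::] = a p [::] * b p [::].
Proof.
rewrite /wedge_form /= (big_pred1 [tuple]) /=; last first.
  by move=> m; rewrite [m]tuple0 /= eqxx.
by rewrite mul1r.
Qed.

Lemma big_tuple_bool (n : nat) (F : seq bool -> R) :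
  \sum_(m : n.+1.-tuple bool) F m =
  \sum_(m : n.-tuple bool) F (true :: m) +
  \sum_(m : n.-tuple bool) F (false :: m).
Proof.
rewrite (reindex (fun bm : bool * n.-tuple bool => [tuple of bm.1 :: bm.2])) /=.
  rewrite -(pair_bigA _ (fun (e : bool) (m : n.-tuple bool) => F (e :: m))) /=.
  by rewrite big_bool.
exists (fun m : n.+1.-tuple bool => (thead m, [tuple of behead m])).
  by case=> b m _ /=; congr (_, _); apply/val_inj.
by move=> m _ /=; rewrite -tuple_eta.
Qed.

(** The antiderivation rule of the contraction.  The shuffles are split by
    whether v goes to the first factor; otherwise v crosses all the arguments
    of that factor, and the resulting sign is the one in [parity].  *)
Lemma wedge_cons a b p v vs :
  wedge_form a b p (v :: vs) =
  wedge_form (iprod v a) b p vs + wedge_form (parity a) (iprod v b) p vs.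
Proof.
rewrite /wedge_form /= (@big_tuple_bool (size vs) (fun m =>
  (-1) ^+ shuffle_inv m * a p (mask m (v :: vs)) *
   b p (mask (map negb m) (v :: vs)))) /=.
congr (_ + _); apply: eq_bigr => m _.
rewrite /parity size_mask ?size_tuple// exprD (mulrC ((-1) ^+ count _ _)).
by rewrite !mulrA.
Qed.

Lemma iprod_wedge v a b :
  iprod v (wedge_form a b) =
  wedge_form (iprod v a) b + wedge_form (parity a) (iprod v b).
Proof. by apply/funext => p; apply/funext => vs; exact: wedge_cons. Qed.

Lemma dR_nil w p : dR w p [::] = 0.
Proof. by rewrite /dR big_ord0. Qed.

(** Cartan's formula i_v d = L_v - d i_v for a constant field v.  Together with
    [wedge_cons] it turns identities between forms into inductions on the list
    of arguments. *)
Lemma dR_cons w p v vs :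
  dR w p (v :: vs) = LieD v w p vs - dR (iprod v w) p vs.
Proof.
rewrite /dR big_ord_recl /= expr0 mul1r drop0; congr (_ + _).
rewrite -sumrN; apply: eq_bigr => i _.
by rewrite /bump /= add1n exprS -!mulrA mulN1r.
Qed.

Lemma iprod_dR v w : iprod v (dR w) = LieD v w - dR (iprod v w).
Proof. by apply/funext => p; apply/funext => vs; exact: dR_cons. Qed.

Ltac form_ext := apply/funext => p; apply/funext => vs.

Lemma addpE a b p vs : (a + b) p vs = a p vs + b p vs. Proof. by []. Qed.
Lemma opppE a p vs : (- a) p vs = - a p vs. Proof. by []. Qed.
Lemma scalepE (c : R) a p vs : (c *: a) p vs = c * a p vs. Proof. by []. Qed.
Lemma zeropE p vs : (0 : preform R) p vs = 0. Proof. by []. Qed.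
Definition preformE := (addpE, opppE, scalepE, zeropE).

Lemma wedgeDl a a' b : wedge_form (a + a') b = wedge_form a b + wedge_form a' b.
Proof.
form_ext; rewrite addpE /wedge_form -big_split; apply: eq_bigr => m _ /=.
by rewrite mulrDr mulrDl.
Qed.

Lemma wedgeDr a b b' : wedge_form a (b + b') = wedge_form a b + wedge_form a b'.
Proof.
form_ext; rewrite addpE /wedge_form -big_split; apply: eq_bigr => m _ /=.
by rewrite mulrDr.
Qed.

Lemma wedgeZl (c : R) a b : wedge_form (c *: a) b = c *: wedge_form a b.
Proof.
form_ext; rewrite scalepE /wedge_form mulr_sumr; apply: eq_bigr => m _ /=.
by rewrite scalepE mulrCA -!mulrA.
Qed.

Lemma wedgeZr (c : R) a b : wedge_form a (c *: b) = c *: wedge_form a b.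
Proof.
form_ext; rewrite scalepE /wedge_form mulr_sumr; apply: eq_bigr => m _ /=.
by rewrite scalepE mulrCA.
Qed.

Lemma wedgeNl a b : wedge_form (- a) b = - wedge_form a b.
Proof. by rewrite -scaleN1r wedgeZl scaleN1r. Qed.

Lemma wedgeNr a b : wedge_form a (- b) = - wedge_form a b.
Proof. by rewrite -scaleN1r wedgeZr scaleN1r. Qed.

Lemma wedge0l b : wedge_form 0 b = 0.
Proof.
by rewrite -[X in wedge_form X](scale0r (0 : preform R)) wedgeZl scale0r.
Qed.

Lemma wedge0r a : wedge_form a 0 = 0.
Proof.
by rewrite -[X in wedge_form _ X](scale0r (0 : preform R)) wedgeZr scale0r.
Qed.

Lemma smooth_formD a b : smooth_form a -> smooth_form b -> smooth_form (a + b).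
Proof. by move=> sa sb vs; exact: smooth_add. Qed.

Lemma smooth_formZ (c : R) a : smooth_form a -> smooth_form (c *: a).
Proof. by move=> sa vs; exact: smooth_scale. Qed.

Lemma smooth_formN a : smooth_form a -> smooth_form (- a).
Proof. by move=> sa; rewrite -scaleN1r; exact: smooth_formZ. Qed.

Lemma smooth_iprod v a : smooth_form a -> smooth_form (iprod v a).
Proof. by move=> sa vs; exact: sa. Qed.

Lemma smooth_LieD v a : smooth_form a -> smooth_form (LieD v a).
Proof. by move=> sa vs; exact: smooth_derive. Qed.

Lemma smooth_parity a : smooth_form a -> smooth_form (parity a).
Proof. by move=> sa vs; exact: smooth_scale. Qed.

Lemma smooth_wedge a b : smooth_form a -> smooth_form b ->
  smooth_form (wedge_form a b).
Proof.
move=> sa sb vs; apply: smooth_sum => m; apply: smooth_mul => //.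
exact: smooth_scale.
Qed.

Lemma smooth_dR a : smooth_form a -> smooth_form (dR a).
Proof.
move=> sa vs; apply: smooth_sum => i; apply: smooth_scale.
exact: smooth_derive.
Qed.

#[local] Hint Resolve smooth_formD smooth_formZ smooth_formN smooth_iprod
  smooth_LieD smooth_parity smooth_wedge smooth_dR : core.

Lemma LieD_dir (c : R) u v a : smooth_form a ->
  LieD (c *: u + v) a = c *: LieD u a + LieD v a.
Proof. by move=> sa; form_ext; exact: derive_smooth_dir. Qed.

Lemma LieD_parity v a : smooth_form a -> LieD v (parity a) = parity (LieD v a).
Proof. by move=> sa; form_ext; exact: derive_smooth_scale. Qed.

Lemma LieD_wedge v a b : smooth_form a -> smooth_form b ->
  LieD v (wedge_form a b) = wedge_form (LieD v a) b + wedge_form a (LieD v b).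
Proof.
move=> sa sb; form_ext; rewrite addpE /LieD /wedge_form derive_smooth_sum.
  rewrite -big_split; apply: eq_bigr => m _ /=.
  rewrite derive_smooth_mul// ?derive_smooth_scale//.
  exact: smooth_scale.
by move=> m; apply: smooth_mul => //; exact: smooth_scale.
Qed.

Lemma dRD a b : smooth_form a -> smooth_form b -> dR (a + b) = dR a + dR b.
Proof.
move=> sa sb; form_ext; rewrite addpE /dR -big_split; apply: eq_bigr => i _ /=.
by rewrite -mulrDr; congr (_ * _); exact: derive_smooth_add.
Qed.

Lemma dRZ (c : R) a : smooth_form a -> dR (c *: a) = c *: dR a.
Proof.
move=> sa; form_ext; rewrite scalepE /dR mulr_sumr; apply: eq_bigr => i _ /=.
by rewrite mulrCA; congr (_ * _); exact: derive_smooth_scale.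
Qed.

Lemma dRN a : smooth_form a -> dR (- a) = - dR a.
Proof. by move=> sa; rewrite -scaleN1r dRZ// scaleN1r. Qed.

Lemma dR0 : dR (0 : preform R) = 0.
Proof.
rewrite -[X in dR X](scale0r (0 : preform R)) dRZ ?scale0r// => vs.
exact: smooth_const.
Qed.

(** Schwarz's theorem, term by term. *)
Lemma LieD_dR v a : smooth_form a -> LieD v (dR a) = dR (LieD v a).
Proof.
move=> sa; form_ext; rewrite /LieD /dR derive_smooth_sum.
  apply: eq_bigr => i _; rewrite derive_smooth_scale; last exact: smooth_derive.
  by rewrite schwarz.
by move=> i; apply: smooth_scale; exact: smooth_derive.
Qed.

Lemma parityK a : parity (parity a) = a.
Proof. by form_ext; rewrite /parity mulrA -expr2 sqrr_sign mul1r. Qed.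

Lemma iprod_parity v a : iprod v (parity a) = - parity (iprod v a).
Proof.
by form_ext; rewrite opppE /iprod /iota_ /parity /= exprS -mulrA mulN1r.
Qed.

Lemma dR_parity a : smooth_form a -> dR (parity a) = - parity (dR a).
Proof.
move=> sa; apply/funext => p; apply/funext => vs.
elim: vs a sa => [|v vs IH] a sa.
  by rewrite opppE /parity !dR_nil mulr0 oppr0.
rewrite opppE {2}/parity !dR_cons iprod_parity dRN ?LieD_parity//; last by auto.
rewrite opppE IH; last by auto.
rewrite opppE /parity /= exprS; ring.
Qed.

(** Contracting both sides with the first argument v reduces the rule for a, b
    to the same rule for i_v a, b and for a, i_v b; the L_v terms match
    because L_v is a derivation.  *)
Lemma dR_wedge a b : smooth_form a -> smooth_form b ->
  dR (wedge_form a b) = wedge_form (dR a) b + wedge_form (parity a) (dR b).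
Proof.
move=> sa sb; apply/funext => p; apply/funext => vs.
elim: vs a b sa sb => [|v vs IH] a b sa sb.
  by rewrite addpE !wedge_nil !dR_nil mul0r mulr0 addr0.
rewrite addpE !wedge_cons dR_cons LieD_wedge// iprod_wedge.
rewrite dRD; [|by auto..].
rewrite !preformE.
rewrite !IH; [|by auto..].
rewrite !iprod_dR iprod_parity parityK dR_parity//.
rewrite !(wedgeDl, wedgeDr, wedgeNl, wedgeNr).
rewrite !preformE.
ring.
Qed.

(** i_v d d = L_v d - d L_v + d d i_v, where the first two terms cancel. *)
Lemma dR_dR a : smooth_form a -> dR (dR a) = 0.
Proof.
move=> sa; apply/funext => p; apply/funext => vs.
elim: vs a sa => [|v vs IH] a sa; first by rewrite dR_nil.
rewrite dR_cons LieD_dR// iprod_dR dRD; [|by auto..].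
rewrite dRN; last by auto.
rewrite !preformE IH; last by auto.
by rewrite subr0 subrr.
Qed.

(** * Closure of differential forms under the operations *)

Definition multilinear w := forall p s t (c : R) u v,
  w p (s ++ (c *: u + v) :: t) = c * w p (s ++ u :: t) + w p (s ++ v :: t).

(** Equivalent to full alternation for multilinear maps, and stable under
    contraction: this makes it the right hypothesis for inductions on the list
    of arguments. *)
Definition adj_alternating w := forall p s t v, w p (s ++ v :: v :: t) = 0.

Lemma iprod_multilinear v w : multilinear w -> multilinear (iprod v w).
Proof. by move=> mw p s t c u u'; exact: (mw p (v :: s)). Qed.

Lemma iprod_alternating v w :
  adj_alternating w -> adj_alternating (iprod v w).
Proof. by move=> aw p s t u; exact: (aw p (v :: s)). Qed.

Lemma parity_multilinear w : multilinear w -> multilinear (parity w).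
Proof. by move=> mw p s t c u v; rewrite /parity mw !size_cat /=; ring. Qed.

Lemma parity_alternating w : adj_alternating w -> adj_alternating (parity w).
Proof. by move=> aw p s t v; rewrite /parity aw mulr0. Qed.

Lemma iprod_dir (c : R) u v w : multilinear w ->
  iprod (c *: u + v) w = c *: iprod u w + iprod v w.
Proof. by move=> mw; form_ext; exact: (mw p [::]). Qed.

Lemma iprod_iprod0 v w : adj_alternating w -> iprod v (iprod v w) = 0.
Proof. by move=> aw; form_ext; exact: (aw p [::]). Qed.

Lemma wedge_multilinear a b : multilinear a -> multilinear b ->
  multilinear (wedge_form a b).
Proof.
move=> ma mb p s t c u v; elim: s a b ma mb => [|x s IH] a b ma mb.
  rewrite !cat0s !wedge_cons !iprod_dir// !(wedgeDl, wedgeDr, wedgeZl, wedgeZr).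
  by rewrite !preformE; ring.
rewrite !cat_cons !wedge_cons !IH; do ?
  by [exact: iprod_multilinear|exact: parity_multilinear|].
ring.
Qed.

(** When the repeated argument v comes first, the terms with i_v i_v vanish and
    the two mixed terms cancel, since i_v anticommutes with [parity]. *)
Lemma wedge_alternating a b : adj_alternating a -> adj_alternating b ->
  adj_alternating (wedge_form a b).
Proof.
move=> aa ab p s t v; elim: s a b aa ab => [|x s IH] a b aa ab.
  rewrite cat0s !wedge_cons !iprod_iprod0// wedge0l wedge0r.
  rewrite iprod_parity wedgeNl preformE.
  by rewrite add0r addr0 addrN.
rewrite cat_cons wedge_cons !IH ?addr0//;
  by [exact: iprod_alternating|exact: parity_alternating].
Qed.

Lemma LieD_multilinear v w : smooth_form w -> multilinear w ->
  multilinear (LieD v w).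
Proof.
move=> sw mw p s t c u u'; rewrite /LieD.
under eq_fun do rewrite mw.
rewrite derive_smooth_add; [|by apply: smooth_scale; exact: sw|exact: sw].
by rewrite derive_smooth_scale//; exact: sw.
Qed.

Lemma dR_multilinear w : smooth_form w -> multilinear w -> multilinear (dR w).
Proof.
move=> sw mw p s t c u v; elim: s w sw mw => [|x s IH] w sw mw.
  rewrite !cat0s !dR_cons iprod_dir// LieD_dir//.
  rewrite dRD; [|by auto..]; rewrite dRZ; last by auto.
  by rewrite !preformE; ring.
rewrite !cat_cons !dR_cons LieD_multilinear// IH; last 2 first.
- by auto.
- exact: iprod_multilinear.
by ring.
Qed.

Lemma dR_alternating w : smooth_form w -> adj_alternating w ->
  adj_alternating (dR w).
Proof.
move=> sw aw p s t v; elim: s w sw aw => [|x s IH] w sw aw.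
  rewrite cat0s !dR_cons iprod_iprod0// dR0.
  by rewrite zeropE subr0; exact: subrr.
rewrite cat_cons dR_cons IH; last 2 first.
- by auto.
- exact: iprod_alternating.
rewrite /LieD; under eq_fun do rewrite aw.
by rewrite derive_cst subrr.
Qed.

(** Adjacent alternation and multilinearity make w change sign under adjacent
    transpositions, which bring the two equal arguments together. *)
Lemma alternating_adj w : multilinear w -> adj_alternating w ->
  forall p s1 s2 s3 v, w p (s1 ++ v :: s2 ++ v :: s3) = 0.
Proof.
move=> mw aw.
have swap p s t u v : w p (s ++ u :: v :: t) = - w p (s ++ v :: u :: t).
  have lin2 x : w p (s ++ x :: (1 *: u + v) :: t) =
      w p (s ++ x :: u :: t) + w p (s ++ x :: v :: t).
    by have := mw p (rcons s x) t 1 u v; rewrite !cat_rcons mul1r.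
  have := aw p s t (1 *: u + v).
  rewrite mw mul1r !lin2 !aw add0r addr0 => /eqP.
  by rewrite addr_eq0 => /eqP.
move=> p s1 s2 s3 v; elim: s2 s1 => [|x s2 IH] s1; first exact: aw.
by rewrite cat_cons swap -cat_rcons IH oppr0.
Qed.

Definition periodic w := forall (i : 'I_4) p vs,
  w (p + (2 * pi) *: delta_mx 0 i) vs = w p vs.

Lemma is_formP w : is_form w <->
  [/\ periodic w, smooth_form w, multilinear w & adj_alternating w].
Proof.
split=> [[pw sw mw aw]|[pw sw mw aw]]; split => //.
  by move=> p s t v; exact: (aw p s [::]).
exact: alternating_adj.
Qed.

Lemma form_wedge a b : is_form a -> is_form b -> is_form (wedge_form a b).
Proof.
move=> /is_formP[pa sa ma aa] /is_formP[pb sb mb ab]; apply/is_formP; split.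
- by move=> i p vs; apply: eq_bigr => m _; rewrite pa pb.
- by auto.
- exact: wedge_multilinear.
- exact: wedge_alternating.
Qed.

Lemma form_dR a : is_form a -> is_form (dR a).
Proof.
move=> /is_formP[pa sa ma aa]; apply/is_formP; split.
- move=> i p vs; apply: eq_bigr => j _; congr (_ * _); rewrite /derive.
  by under eq_fun do rewrite /= addrA !pa.
- by auto.
- exact: dR_multilinear.
- exact: dR_alternating.
Qed.

Lemma form_iprod v a : is_form a -> is_form (iprod v a).
Proof.
move=> /is_formP[pa sa ma aa]; apply/is_formP; split.
- by move=> i p vs; exact: pa.
- by auto.
- exact: iprod_multilinear.
- exact: iprod_alternating.
Qed.

Lemma form_lin (c : R) a b : is_form a -> is_form b -> is_form (c *: a + b).
Proof.
move=> /is_formP[pa sa ma aa] /is_formP[pb sb mb ab]; apply/is_formP; split.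
- by move=> i p vs; rewrite !preformE pa pb.
- by auto.
- by move=> p s t k u v; rewrite !preformE ma mb; ring.
- by move=> p s t v; rewrite !preformE aa ab mulr0 addr0.
Qed.

Lemma form_add a b : is_form a -> is_form b -> is_form (a + b).
Proof. by move=> fa fb; rewrite -(scale1r a); exact: form_lin. Qed.

Lemma form_sub a b : is_form a -> is_form b -> is_form (a - b).
Proof. by move=> fa fb; rewrite addrC -scaleN1r; exact: form_lin. Qed.

Lemma smooth_form_of a : is_form a -> smooth_form a.
Proof. by case/is_formP. Qed.

(** * Homogeneous forms *)

(** Degrees as natural numbers, so that degree arithmetic is computation. *)
Definition of_degree (n : nat) w := forall p vs, size vs != n -> w p vs = 0.

Lemma homogeneousP (n : nat) w : homogeneous n%:Z w <-> of_degree n w.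
Proof.
split=> H p vs n_vs; apply: H; first by move=> [E]; rewrite E eqxx in n_vs.
by apply/eqP => E; apply: n_vs; rewrite E.
Qed.

Lemma degree_wedge m n a b : of_degree m a -> of_degree n b ->
  of_degree (m + n) (wedge_form a b).
Proof.
move=> da db p vs N; apply: big1 => k _.
have [E|] := eqVneq (size (mask k vs)) m; last first.
  by move=> /(da p) ->; rewrite mulr0 mul0r.
rewrite [b _ _]db ?mulr0//; apply: contra N => /eqP F.
rewrite -E -F !size_mask ?size_map ?size_tuple// count_map.
by rewrite (count_predC id) size_tuple.
Qed.

Lemma degree_dR n a : of_degree n a -> of_degree n.+1 (dR a).
Proof.
move=> da p vs N; apply: big1 => i _.
have N' : size (take i vs ++ drop i.+1 vs) != n.
  rewrite size_cat size_takel 1?ltnW// size_drop.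
  by apply: contra N => /eqP <-; rewrite -addSn subnKC.
rewrite (_ : a ^~ _ = fun=> 0) ?derive_cst ?mulr0//.
by apply/funext => q; exact: da.
Qed.

Lemma degree_iprod n v a : of_degree n.+1 a -> of_degree n (iprod v a).
Proof. by move=> da p vs N; exact: da. Qed.

Lemma degree_lin n (c : R) a b : of_degree n a -> of_degree n b ->
  of_degree n (c *: a + b).
Proof. by move=> da db p vs N; rewrite !preformE da// db// mulr0 addr0. Qed.

Lemma degree_add n a b : of_degree n a -> of_degree n b -> of_degree n (a + b).
Proof. by move=> da db; rewrite -(scale1r a); exact: degree_lin. Qed.

Lemma degree_sub n a b : of_degree n a -> of_degree n b -> of_degree n (a - b).
Proof. by move=> da db; rewrite addrC -scaleN1r; exact: degree_lin. Qed.

Lemma parity_degree n a : of_degree n a -> parity a = (-1) ^+ n *: a.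
Proof.
move=> da; form_ext; rewrite scalepE /parity.
have [->//|N] := eqVneq (size vs) n.
by rewrite da// !mulr0.
Qed.

Lemma wedge11 a b p u v : of_degree 1 a -> of_degree 1 b ->
  wedge_form a b p [:: u; v] =
  a p [:: u] * b p [:: v] - a p [:: v] * b p [:: u].
Proof.
move=> da db; rewrite !wedge_cons !wedge_nil (parity_degree da).
rewrite /iprod /iota_ /parity /= !preformE /= (da p [:: u; v])// (da p [::])//.
by rewrite (db p [::])// /=; ring.
Qed.

Lemma wedge11C a b : of_degree 1 a -> of_degree 1 b ->
  wedge_form a b = - wedge_form b a.
Proof.
move=> da db; form_ext; rewrite opppE.
have dab := degree_wedge da db; have dba := degree_wedge db da.
case: vs => [|u [|v [|x vs]]]; try by rewrite dab// dba// oppr0.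
by rewrite !wedge11//; ring.
Qed.
End Forms.

(** * The bracket of closed 2-forms *)

Section Koszul.
Context {R : realType}.
Local Notation V := 'rV[R]_4.
Implicit Types (a b w : preform R) (p u v x y : V) (vs : seq V).
#[local] Hint Resolve smooth_formD smooth_formZ smooth_formN smooth_iprod
  smooth_LieD smooth_parity smooth_wedge smooth_dR : core.

(** The part of i_X i_Y (a /\ b) in which a and b are contracted once each, for
    2-forms a and b. *)
Definition contraction_pairing x y a b : preform R :=
  wedge_form (iprod x a) (iprod y b) -
  wedge_form (iprod y a) (iprod x b).
Local Notation Q := contraction_pairing.

Lemma Lie2_closed x y a : smooth_form a -> dR a = 0 ->
  Lie2 (fun=> x) (fun=> y) a = - dR (iprod x (iprod y a)).
Proof. by move=> sa da; rewrite /Lie2 da -[LHS]/(0 - _) sub0r. Qed.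

(** Since d(a /\ b) = 0, L_pi(a /\ b) is minus the derivative of i_X i_Y (a /\
    b).  Of the four terms of this contraction, the two in which both
    contractions hit the same factor are cancelled by the two correction terms
    of lambda_2.  *)
Lemma lambda2_closed x y a b : smooth_form a -> smooth_form b ->
  of_degree 2 a -> of_degree 2 b -> dR a = 0 -> dR b = 0 ->
  lambda2 (fun=> x) (fun=> y) a b = dR (Q x y a b).
Proof.
move=> sa sb d2a d2b da db.
have pa : parity a = a by rewrite (parity_degree d2a) sqrrN expr1n scale1r.
have p1 u : parity (iprod u a) = - iprod u a.
  by rewrite (parity_degree (degree_iprod u d2a)) expr1 scaleN1r.
have p0 u v : parity (iprod u (iprod v a)) = iprod u (iprod v a).
  by rewrite (parity_degree (degree_iprod u (degree_iprod v d2a)))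
    expr0 scale1r.
rewrite /lambda2 !Lie2_closed//; last 2 first.
- by auto.
- by rewrite dR_wedge// da db pa wedge0l wedge0r addr0.
rewrite iprod_wedge pa -[iprod x (_ + _)]/(iprod x _ + iprod x _).
rewrite !iprod_wedge p1 pa /contraction_pairing.
rewrite wedgeNl !dRD; try by auto 10.
rewrite !dRN; try by auto.
rewrite (@dR_wedge _ _ b)//; try by auto.
rewrite (@dR_wedge _ a)//; try by auto.
rewrite p0 pa da db wedge0r wedge0l wedgeNl wedgeNr.
by apply/funext => p; apply/funext => vs; rewrite !preformE; ring.
Qed.


(** Cartan's formula moves d across the contractions; the terms with dv cancel
    those of Q(a, dv).  In what is left every product has a Lie derivative of a
    or of v as a factor, so it is horizontal when a and v are. *)
Lemma pairing_exact x y a (v : preform R) : smooth_form a -> smooth_form v ->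
  of_degree 2 a -> dR a = 0 ->
  Q x y a (dR v) - dR (Q x y a v) =
  (wedge_form (iprod x a) (LieD y v) - wedge_form (iprod y a) (LieD x v)) -
  (wedge_form (LieD x a) (iprod y v) - wedge_form (LieD y a) (iprod x v)).
Proof.
move=> sa sv d2a da.
have p1 u : parity (iprod u a) = - iprod u a.
  by rewrite (parity_degree (degree_iprod u d2a)) expr1 scaleN1r.
have di u b : dR (iprod u b) = LieD u b - iprod u (dR b).
  by rewrite iprod_dR opprB addrC subrK.
rewrite /Q dRD; try by auto.
rewrite dRN; try by auto.
rewrite !dR_wedge; try by auto.
rewrite !p1 !di da.
rewrite !(wedgeDl, wedgeDr, wedgeNl, wedgeNr) -[iprod x 0]/(0 : preform R).
rewrite -[iprod y 0]/(0 : preform R) !wedge0l.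
by apply/funext => p; apply/funext => vs; rewrite !preformE; ring.
Qed.

(** Q is symmetric on 2-forms, because 1-forms anticommute. *)
Lemma pairingD x y a b : of_degree 2 a -> of_degree 2 b ->
  Q x y (a + b) (a + b) = Q x y a a + Q x y (a + (a + b)) b.
Proof.
move=> da db; rewrite /Q.
have iD u c d : iprod u (c + d) = iprod u c + iprod u d by [].
rewrite !iD !(wedgeDl, wedgeDr).
rewrite (wedge11C (degree_iprod x db) (degree_iprod y da)).
rewrite (wedge11C (degree_iprod y db) (degree_iprod x da)).
by apply/funext => p; apply/funext => vs; rewrite !preformE; ring.
Qed.

Lemma form_pairing x y a b : is_form a -> is_form b -> is_form (Q x y a b).
Proof.
by move=> fa fb; apply: form_sub; apply: form_wedge; exact: form_iprod.
Qed.

Lemma degree_pairing x y m n a b : of_degree m.+1 a -> of_degree n.+1 b ->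
  of_degree (m + n) (Q x y a b).
Proof.
by move=> da db; apply: degree_sub; apply: degree_wedge; exact: degree_iprod.
Qed.

(** * Horizontal forms on the torus *)

Lemma degree_dtheta (i : 'I_4) : of_degree 1 (dtheta R i).
Proof. by move=> p [|u [|v vs]]. Qed.

Lemma etaE p u v : eta R p [:: u; v] = u 0 t3 * v 0 t4 - v 0 t3 * u 0 t4.
Proof. by rewrite /eta wedge11//; exact: degree_dtheta. Qed.

Lemma ker_etaP p v : ker_dist (eta R) p v <-> v 0 t3 = 0 /\ v 0 t4 = 0.
Proof.
split=> [kv|[v3 v4] u]; last by rewrite etaE v3 v4 mul0r mulr0 subrr.
split.
  by have := kv (delta_mx 0 t4); rewrite etaE !mxE /= mulr1 mul0r subr0.
have := kv (delta_mx 0 t3); rewrite etaE !mxE /= mulr0 mul1r sub0r => /eqP.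
by rewrite oppr_eq0 => /eqP.
Qed.

Lemma rV4E (v : V) : v = v 0 t1 *: delta_mx 0 t1 + v 0 t2 *: delta_mx 0 t2 +
  (v 0 t3 *: delta_mx 0 t3 + v 0 t4 *: delta_mx 0 t4).
Proof.
apply/rowP => -[[|[|[|[|//]]]] i4]; rewrite !mxE /= ?mulr1 ?mulr0 ?addr0 ?add0r;
  by congr (v _ _); apply/val_inj.
Qed.

Lemma ker_eta p : ker_dist (eta R) p = span2 (ptl R t1) (ptl R t2) p.
Proof.
apply/seteqP; split=> v.
  move=> /ker_etaP[v3 v4]; exists (v 0 t1), (v 0 t2).
  by rewrite {1}[v]rV4E v3 v4 !scale0r !addr0.
move=> [a [b ->]]; apply/ker_etaP.
by rewrite !mxE /= !mulr0 addr0.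
Qed.

Lemma eta_split p v : exists! kg : V * V,
  [/\ ker_dist (eta R) p kg.1, Gdist R p kg.2 & v = kg.1 + kg.2].
Proof.
exists (v 0 t1 *: delta_mx 0 t1 + v 0 t2 *: delta_mx 0 t2,
        v 0 t3 *: delta_mx 0 t3 + v 0 t4 *: delta_mx 0 t4); split.
  split=> /=; last exact: rV4E.
    by apply/ker_etaP; rewrite !mxE /= !mulr0 addr0.
  by exists (v 0 t3), (v 0 t4).
move=> [k g] /= [/ker_etaP[k3 k4] [c [d gE]] ->].
rewrite !mxE k3 k4 gE !mxE /= !mulr0 !mulr1 !addr0 !add0r; congr (_, _).
by rewrite {3}[k]rV4E k3 k4 !scale0r !addr0.
Qed.

Lemma horizontalP w : horizontal (eta R) w <->
  forall p vs, (forall v, v \in vs -> v 0 t3 = 0 /\ v 0 t4 = 0) -> w p vs = 0.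
Proof.
by split=> H p vs Hvs; apply: H => v /Hvs /ker_etaP.
Qed.

(** Horizontal forms are an ideal: the sublists of a list of kernel vectors
    consist of kernel vectors. *)
Lemma horizontal_wedgel a b : horizontal (eta R) a ->
  horizontal (eta R) (wedge_form a b).
Proof.
move=> ha p vs Hvs; apply: big1 => m _; rewrite [a _ _]ha ?mulr0 ?mul0r//.
by move=> v /mem_mask /Hvs.
Qed.

Lemma horizontal_wedger a b : horizontal (eta R) b ->
  horizontal (eta R) (wedge_form a b).
Proof.
move=> hb p vs Hvs; apply: big1 => m _; rewrite [b _ _]hb ?mulr0//.
by move=> v /mem_mask /Hvs.
Qed.

(** The kernel of eta does not depend on the point. *)
Lemma horizontal_LieD v a :
  horizontal (eta R) a -> horizontal (eta R) (LieD v a).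
Proof.
move=> /horizontalP ha; apply/horizontalP => p vs Hvs.
rewrite /LieD (_ : a ^~ vs = fun=> 0) ?derive_cst//.
by apply/funext => q; exact: ha.
Qed.

Lemma horizontal_lin (c : R) a b : horizontal (eta R) a ->
  horizontal (eta R) b -> horizontal (eta R) (c *: a + b).
Proof.
by move=> ha hb p vs Hvs; rewrite !preformE ha// hb// mulr0 addr0.
Qed.

Lemma horizontal_add a b : horizontal (eta R) a -> horizontal (eta R) b ->
  horizontal (eta R) (a + b).
Proof. by move=> ha hb; rewrite -(scale1r a); exact: horizontal_lin. Qed.

Lemma horizontal_sub a b : horizontal (eta R) a -> horizontal (eta R) b ->
  horizontal (eta R) (a - b).
Proof. by move=> ha hb; rewrite addrC -scaleN1r; exact: horizontal_lin. Qed.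

(** Kernel vectors are combinations of two vectors e1 and e2, one of which is
    repeated in every term of the multilinear expansion. *)
Lemma horizontal3 w : is_form w -> of_degree 3 w -> horizontal (eta R) w.
Proof.
move=> fw dw; apply/horizontalP => p vs.
case: vs => [|u [|v [|x [|z vs]]]] Hvs; try by rewrite dw.
have lin2 s t (c d : R) e f : w p (s ++ (c *: e + d *: f) :: t) =
    c * w p (s ++ e :: t) + d * w p (s ++ f :: t).
  have w0 : w p (s ++ 0 :: t) = 0.
    have := form_multilinear fw p s t 1 0 0.
    by rewrite scaler0 addr0 mul1r -[LHS]addr0 => /addrI <-.
  rewrite (form_multilinear fw); congr (_ + _).
  by rewrite -[X in s ++ X :: _]addr0 (form_multilinear fw) w0 addr0.
have [e1 [e2 kE]] : exists e1 e2 : V, forall k : V, k 0 t3 = 0 /\ k 0 t4 = 0 ->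
    exists c d, k = c *: e1 + d *: e2.
  exists (delta_mx 0 t1), (delta_mx 0 t2) => k [k3 k4].
  exists (k 0 t1), (k 0 t2).
  by rewrite [LHS]rV4E k3 k4 !scale0r !addr0.
have A12 e f : w p [:: e; e; f] = 0 := form_alternating fw p [::] [::] [:: f] e.
have A13 e f : w p [:: e; f; e] = 0 := form_alternating fw p [::] [:: f] [::] e.
have A23 e f : w p [:: f; e; e] = 0 := form_alternating fw p [:: f] [::] [::] e.
have [|c1 [d1 ->]] := kE u; first by apply: Hvs; rewrite !inE eqxx.
have [|c2 [d2 ->]] := kE v; first by apply: Hvs; rewrite !inE eqxx orbT.
have [|c3 [d3 ->]] := kE x; first by apply: Hvs; rewrite !inE eqxx !orbT.
have L1 := lin2 [::]; have L2 e := lin2 [:: e]; have L3 e f := lin2 [:: e; f].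
rewrite /= in L1 L2 L3.
rewrite L1 !L2 !L3 !A12 !A13 !A23; ring.
Qed.

(** * The Kuranishi map *)

Local Notation W := (torus_koszul R).
Local Notation X := (delta_mx 0 t3 : V).
Local Notation Y := (delta_mx 0 t4 : V).

Lemma componentP (k : int) (n : nat) (w : W) : k + 2 = n%:Z ->
  component k w <-> [/\ is_form w, of_degree n w & horizontal (eta R) w].
Proof.
move=> kn; rewrite /component /= kn.
by split=> -[fw dw hw]; split => //; exact/homogeneousP.
Qed.

Definition component0P := @componentP 0 2 ^~ erefl.
Definition component1P := @componentP 1 3 ^~ erefl.
(** Degrees 0 - 1 and 1 - 1 are those of the primitives in [cls 0] and [cls 1];
    their homogeneous components are the 1-forms and the 2-forms. *)
Definition component_pred0P := @componentP (0 - 1) 1 ^~ erefl.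
Definition component_pred1P := @componentP (1 - 1) 2 ^~ erefl.

Lemma lam2E (w : W) : cocycle 0 w -> lam [:: w; w] = dR (Q X Y w w).
Proof.
move=> [/component0P[fw dw _] cw]; apply: lambda2_closed => //;
  exact: smooth_form_of.
Qed.

Lemma cocycle_lam2 (w : W) : cocycle 0 w -> cocycle 1 (lam [:: w; w]).
Proof.
move=> cw; rewrite lam2E//; have [/component0P[fw dw _] _] := cw.
have fQ := form_pairing X Y fw fw.
split; last by apply: dR_dR; exact: smooth_form_of.
have fdQ := form_dR fQ; have ddQ := degree_dR (degree_pairing X Y dw dw).
by apply/component1P; split => //; exact: horizontal3.
Qed.

Lemma cls_refl (k : int) (w : W) : cocycle k w -> component (k - 1) (0 : W) ->
  cls k w w.
Proof.
move=> cw c0; split=> //; exists 0 => //.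
by rewrite [lam _]dR0 addr0.
Qed.

Lemma form0 : is_form (0 : preform R).
Proof.
split=> //.
- by move=> vs; exact: smooth_const.
- by move=> p s1 s2 c u v; rewrite !zeropE mulr0 addr0.
Qed.

Lemma component_zero (k : int) : component k (0 : W).
Proof. by split => //; exact: form0. Qed.

Lemma component_lin (k : int) (c : R) (a b : W) :
  component k a -> component k b -> component k (c *: a + b).
Proof.
move=> [fa da ha] [fb db hb]; split; first exact: form_lin.
  move=> p vs N; rewrite -[LHS]/(c * a p vs + b p vs).
  by rewrite (da p vs N) (db p vs N) mulr0 addr0.
exact: horizontal_lin.
Qed.

(** With w' = w + dv, the difference Q(w', w') - Q(w, w) is Q(w + w', dv), which
    by [pairing_exact] differs from an exact form by a horizontal one. *)
Lemma lam2_cohomologous (w v : W) : cocycle 0 w -> cocycle 0 (w + lam [:: v]) ->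
  component (0 - 1) v ->
  exists2 z : W, component (1 - 1) z &
    lam [:: w + lam [:: v]; w + lam [:: v]] = lam [:: w; w] + dR z.
Proof.
move=> cw cw' /component_pred0P[fv dv hv].
have [/component0P[fw dw hw] dw0] := cw.
have [/component0P[fw' dw' hw'] dw'0] := cw'.
set u := lam [:: v] in cw' fw' dw' hw' dw'0 *.
have fu : is_form u by exact: form_dR.
have du : of_degree 2 u by exact: degree_dR.
pose a : preform R := w + (w + u).
have fa : is_form a by exact: form_add.
have da : of_degree 2 a by exact: degree_add.
have ha : horizontal (eta R) a by exact: horizontal_add.
have da0 : dR a = 0.
  rewrite dRD; do ?exact: smooth_form_of.
  by rewrite [dR w]dw0 [dR (w + u)]dw'0 addr0.
have fS : is_form (Q X Y a u - dR (Q X Y a v)).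
  by apply: form_sub; [|apply: form_dR]; exact: form_pairing.
exists (Q X Y a u - dR (Q X Y a v)).
  apply/component_pred1P; split=> //.
    apply: degree_sub; first exact: (degree_pairing _ _ da du).
    exact: degree_dR (degree_pairing _ _ da dv).
  rewrite pairing_exact//; do ?exact: smooth_form_of.
  apply: horizontal_sub; apply: horizontal_sub; by
    [apply: horizontal_wedger; exact: horizontal_LieD
    |apply: horizontal_wedgel; exact: horizontal_LieD].
rewrite !lam2E// pairingD//.
have fQ b c : is_form b -> is_form c -> smooth_form (Q X Y b c).
  by move=> fb fc; exact/smooth_form_of/form_pairing.
rewrite dRD; [|exact: fQ|exact: fQ].
congr (_ + _); rewrite dRD; [|exact: fQ|]; last first.
  by apply: smooth_formN; apply: smooth_dR; exact: fQ.
rewrite dRN; last by apply: smooth_dR; exact: fQ.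
by rewrite dR_dR ?subr0//; exact: fQ.
Qed.

Lemma torus_Kr_well_defined : Kr_well_defined W.
Proof.
move=> w cw; split; first exact: cocycle_lam2.
apply/seteqP; split=> x; last first.
  by move=> xw; exists w => //; apply: cls_refl => //; exact: component_zero.
move=> [w' [cw' [v cv w'E]] [cx [v' cv' xE]]]; split=> //.
rewrite w'E in cw' xE.
have [z cz zE] := lam2_cohomologous cw cw' cv.
exists (z + v').
  move: cz cv' => /component_pred1P[fz dz hz] /component_pred1P[fv' dv' hv'].
  apply/component_pred1P; split; first exact: form_add.
    exact: degree_add.
  exact: horizontal_add.
rewrite xE zE -addrA; congr (_ + _); rewrite [RHS]dRD//.
- by case/component_pred1P: cz => /smooth_form_of.
- by case/component_pred1P: cv' => /smooth_form_of.
Qed.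

(** * The forms eta and B *)

Lemma form_dtheta (i : 'I_4) : is_form (dtheta R i).
Proof.
split=> //.
- by move=> vs; exact: smooth_const.
- move=> p [|x [|y s1]] [|z s2] c u v //=; rewrite ?mulr0 ?addr0//.
  by rewrite !mxE.
- by move=> p [|x [|y s1]] [|z s2] [|t s3] v.
Qed.

Lemma form_fmul (f : V -> R) w : smooth_fun f ->
  (forall (i : 'I_4) p, f (p + (2 * pi) *: delta_mx 0 i) = f p) ->
  is_form w -> is_form (fmul f w).
Proof.
move=> sf pf [pw sw mw aw]; split.
- by move=> i p vs; rewrite /fmul pf pw.
- by move=> vs; apply: smooth_mul.
- by move=> p s1 s2 c u v; rewrite /fmul mw; ring.
- by move=> p s1 s2 s3 v; rewrite /fmul aw mulr0.
Qed.

Lemma horizontal_fmul f w :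
  horizontal (eta R) w -> horizontal (eta R) (fmul f w).
Proof. by move=> hw p vs Hvs; rewrite /fmul hw// mulr0. Qed.

Lemma degree_fmul n f w : of_degree n w -> of_degree n (fmul f w).
Proof. by move=> dw p vs N; rewrite /fmul dw// mulr0. Qed.

Lemma horizontal_dtheta (i : 'I_4) : i = t3 \/ i = t4 ->
  horizontal (eta R) (dtheta R i).
Proof.
move=> it; apply/horizontalP => p [|u [|v vs]] //= H.
have [] := H u (mem_head _ _).
by case: it => ->.
Qed.

Lemma torus_presymplectic : presymplectic (eta R).
Proof.
have de : of_degree 2 (eta R).
  by apply: (@degree_wedge _ 1 1); exact: degree_dtheta.
split.
- by apply: form_wedge; exact: form_dtheta.
- exact/homogeneousP.
- apply/funext => p; apply/funext => vs; apply: big1 => i _.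
  rewrite (_ : eta R ^~ _ = cst (eta R 0 (take i vs ++ drop i.+1 vs))).
    by rewrite derive_cst mulr0.
  by [].
- by exists (\rank (\matrix_(i < 4, j < 4)
    eta R 0 [:: delta_mx 0 i : 'rV[R]_4; delta_mx 0 j])) => p.
Qed.

Lemma BE p u v : B R p [:: u; v] =
  cos (p 0 t3) * (u 0 t1 * v 0 t3 - v 0 t1 * u 0 t3) +
  cos (p 0 t4) * (u 0 t2 * v 0 t4 - v 0 t2 * u 0 t4).
Proof.
by rewrite [LHS]/(_ * _ + _ * _) !wedge11//; exact: degree_dtheta.
Qed.

Lemma cos_coord_periodic (i j : 'I_4) (p : V) :
  cos ((p + (2 * pi) *: delta_mx 0 i) 0 j) = cos (p 0 j).
Proof.
rewrite !mxE /=; case: eqVneq => _; rewrite ?mulr0 ?addr0// mulr1.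
by rewrite mulr_natl mulr2n addrA !cosDpi opprK.
Qed.

Lemma degree_B : of_degree 2 (B R).
Proof.
by apply: degree_add; apply: degree_fmul; apply: (@degree_wedge _ 1 1);
  exact: degree_dtheta.
Qed.

Lemma form_B : is_form (B R).
Proof.
by apply: form_add; apply: form_fmul; do ?[exact: smooth_cos
  |by move=> i p; exact: cos_coord_periodic
  |by apply: form_wedge; exact: form_dtheta].
Qed.

Lemma horizontal_B : horizontal (eta R) (B R).
Proof.
apply: horizontal_add; apply: horizontal_fmul; apply: horizontal_wedger;
  apply: horizontal_dtheta; by [left|right].
Qed.

Lemma dR3 w p u v x : dR w p [:: u; v; x] =
  'D_u (w ^~ [:: v; x]) p - 'D_v (w ^~ [:: u; x]) p + 'D_x (w ^~ [:: u; v]) p.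
Proof.
by rewrite !dR_cons dR_nil subr0 opprB addrA addrAC.
Qed.

Lemma derive_B p x u v : 'D_x (B R ^~ [:: u; v]) p =
  - (sin (p 0 t3) * x 0 t3) * (u 0 t1 * v 0 t3 - v 0 t1 * u 0 t3) -
  (sin (p 0 t4) * x 0 t4) * (u 0 t2 * v 0 t4 - v 0 t2 * u 0 t4).
Proof.
under eq_fun do rewrite BE.
rewrite derive_smooth_add; do ?by apply: smooth_mul;
  [exact: smooth_cos|exact: smooth_const].
rewrite !derive_smooth_mul; do ?[exact: smooth_cos|exact: smooth_const].
by rewrite !derive_cos !derive_cst !mulr0 !addr0 !mulNr.
Qed.

Lemma dR_B : dR (B R) = 0.
Proof.
apply/funext => p; apply/funext => vs.
have [|N] := eqVneq (size vs) 3%N; last by rewrite (degree_dR degree_B).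
case: vs => [|u [|v [|x [|]]]] // _.
by rewrite dR3 !derive_B zeropE; ring.
Qed.

Lemma cocycle_B : cocycle 0 (B R).
Proof.
split; last exact: dR_B.
apply/component0P.
by split; [exact: form_B|exact: degree_B|exact: horizontal_B].
Qed.

Lemma pairing_B p : Q X Y (B R) (B R) p [:: delta_mx 0 t1; delta_mx 0 t2] =
  2 * (cos (p 0 t3) * cos (p 0 t4)).
Proof.
have dB v := degree_iprod v degree_B.
rewrite /Q !preformE !wedge11// /iprod /iota_ !BE !mxE /=.
by ring.
Qed.

(** * The obstruction *)

Lemma lam2_B_not_exact (z : W) : component 0 z -> lam [:: B R; B R] <> dR z.
Proof.
move=> /component0P[fz dz hz]; rewrite (lam2E cocycle_B) => Ez.
pose C : preform R := Q X Y (B R) (B R) - z.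
have fC : is_form C.
  by apply: form_sub => //; apply: form_pairing; exact: form_B.
have C0 : dR C = 0.
  rewrite dRD; [|exact/smooth_form_of/form_pairing/form_B/form_B|].
    by rewrite dRN ?Ez ?subrr//; exact: smooth_form_of.
  by apply: smooth_formN; exact: smooth_form_of.
(* z vanishes on the kernel, so only Q(B, B) contributes. *)
have C12 : C ^~ [:: delta_mx 0 t1; delta_mx 0 t2] =
    fun q => 2 * (cos (q 0 t3) * cos (q 0 t4)).
  apply/funext => q; rewrite /C preformE pairing_B opppE.
  rewrite (_ : z q _ = 0) ?subr0//; apply: (horizontalP z).1 => // v.
  by rewrite !inE => /orP[] /eqP ->; rewrite !mxE.
have [pC sC _ _] := fC.
pose f := C ^~ [:: delta_mx 0 t2; X].
pose g q := -1 * C q [:: delta_mx 0 t1; X].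
have sg : smooth_fun g by apply: smooth_scale.
have := @torus_no_constant_divergence R f g (delta_mx 0 t1) (delta_mx 0 t2)
  (2 * pi) 2 ((pi / 2) *: X).
have /[swap]/[apply] : 0 < 2 * pi :> R by rewrite mulr_gt0// pi_gt0.
move=> /(_ (sC _) sg (fun q => pC t1 q _)) H.
(* At theta_3 = pi / 2 and theta_4 = 0 the derivative of
   2 cos(theta_3) cos(theta_4) along theta_3 is - 2. *)
suff : (2 : R) = 0 by apply/eqP; rewrite pnatr_eq0.
apply: H => [q|s t]; first by rewrite /g pC.
set q := (X in 'D_(delta_mx 0 t1) f X).
have : dR C q [:: delta_mx 0 t1; delta_mx 0 t2; X] = 0 by rewrite C0.
rewrite dR3 C12 derive_smooth_scale; last first.
  by apply: smooth_mul; exact: smooth_cos.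
rewrite derive_smooth_mul; do ?exact: smooth_cos.
rewrite !derive_cos derive_smooth_scale; last exact: sC.
have -> : q 0 t3 = pi / 2 by rewrite !mxE /= !mulr0 mulr1 !addr0.
have -> : q 0 t4 = 0 by rewrite !mxE /= !mulr0 !addr0.
rewrite sin_pihalf cos0 !mxE /= !(mulr0, mulr1) oppr0 mulr0 addr0 mulrN1 mulN1r.
by move=> /eqP; rewrite subr_eq0 => /eqP.
Qed.

(** The tuples of positive integers with sum 2 are (2) and (1, 1). *)
Lemma MC_coef2 (ws : nat -> W) :
  MC_coef ws 2 = lam [:: ws 2%N] + (2 : R)^-1 *: lam [:: ws 1%N; ws 1%N].
Proof.
rewrite /MC_coef big_nat_recl// big_nat1; congr (_ + _).
  rewrite (big_pred1 [tuple (@Ordinal 3 2 isT)]) /=.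
    by rewrite invr1 scale1r.
  case/tupleP => x s; rewrite (tuple0 s) /= !big_cons big_nil.
  by case: x => -[|[|[|]]].
congr (_ *: _).
rewrite (big_pred1 [tuple (@Ordinal 3 1 isT); (@Ordinal 3 1 isT)]) //=.
case/tupleP => x; case/tupleP => y s; rewrite (tuple0 s) /= !big_cons big_nil.
by case: x => -[|[|[|]]]//= i; case: y => -[|[|[|]]].
Qed.

Lemma torus_formally_obstructed : formally_obstructed W.
Proof.
exists (cls 0 (B R)); first by exists (B R) => //; exact: cocycle_B.
move=> w [cw [v cv wE]] [ws [cws ws1 MC]].
rewrite wE in cw.
have [z cz zE] := lam2_cohomologous cocycle_B cw cv.
have := MC 2%N; rewrite MC_coef2 ws1 wE zE => E.
have c2 := cws 2%N isT.
apply: (@lam2_B_not_exact ((-2) *: ws 2%N + ((-1) *: z + 0))).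
  by do 2!apply: component_lin => //; exact: component_zero.
have [/smooth_form_of s2 _ _] := (component0P _).1 c2.
have [/smooth_form_of sz _ _] := (component_pred1P _).1 cz.
rewrite addr0 scaleN1r dRD; [|exact: smooth_formZ|exact: smooth_formN].
rewrite dRN// dRZ//; apply/funext => p; apply/funext => vs.
have := congr1 (fun w : preform R => w p vs) E; rewrite /= !preformE => Ep.
lra.
Qed.

Lemma Kr_B_neq0 : Kr (cls 0 (B R)) <> cls 1 (0 : W).
Proof.
have [cB ->] := torus_Kr_well_defined cocycle_B => E.
have : cls 1 (lam [:: B R; B R]) (lam [:: B R; B R]).
  exact: (cls_refl cB (component_zero _)).
rewrite E => -[_ [z cz]]; rewrite add0r; exact: lam2_B_not_exact.
Qed.

End Koszul.

Theorem mainTheorem5 (R : realType) :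
  presymplectic (eta R) /\
  (forall p, ker_dist (eta R) p = span2 (ptl R t1) (ptl R t2) p) /\
  (forall p v, exists! kg : 'rV[R]_4 * 'rV[R]_4,
     [/\ ker_dist (eta R) p kg.1, Gdist R p kg.2 & v = kg.1 + kg.2]) /\
  Kr_well_defined (torus_koszul R) /\
  cocycle 0 (B R) /\
  Kr (cls 0 (B R)) = cls 1 (lam [:: B R; B R]) /\
  Kr (cls 0 (B R)) <> cls 1 0 /\
  (exists2 c, cohomology 0 c & @Kr R (torus_koszul R) c <> cls 1 0) /\
  formally_obstructed (torus_koszul R).
Proof.
split; first exact: torus_presymplectic.
split; first exact: ker_eta.
split; first exact: eta_split.
split; first exact: torus_Kr_well_defined.
split; first exact: cocycle_B.
split; first exact: (torus_Kr_well_defined (cocycle_B (R := R))).2.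
split; first exact: Kr_B_neq0.
split; last exact: torus_formally_obstructed.
exists (cls 0 (B R)); last exact: Kr_B_neq0.
by exists (B R) => //; exact: cocycle_B.
Qed.
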